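(* For every graph class $\mathcal{G}$, the underlying treewidth of $\mathcal{G}$ equals the minimum $c\in\mathbb{N}_0$ such that for some function $g:\mathbb{N}_0\to\mathbb{N}$, every graph $G\in\mathcal{G}$ has a $(c,g(\mathrm{tw}(G)))$-disjointed $g(\mathrm{tw}(G))$-partition (in particular, one side is unbounded iff the other is).
   Context: Graphs are finite, simple and undirected; $\mathrm{tw}$ denotes treewidth; a graph class is a set of graphs closed under isomorphism. For graphs $G,H$, an $H$-partition of $G$ is a partition $(V_x : x\in V(H))$ of $V(G)$ such that for every edge $vw$ of $G$ with $v\in V_x$, $w\in V_y$, either $x=y$ or $xy\in E(H)$; its width is $\max_x|V_x|$. $\mathrm{tpw}_c(G)$ is the minimum width of an $H$-partition of $G$ over all graphs $H$ with $\mathrm{tw}(H)\le c$. The underlying treewidth of $\mathcal{G}$ is the minimum $c\in\mathbb{N}_0$ for which there is a function $f$ with $\mathrm{tpw}_c(G)\le f(\mathrm{tw}(G))$ for all $G\in\mathcal{G}$ (unbounded if no such $c$ exists). For $B\subseteq V(G)$, $N_G(B)$ is the set of vertices adjacent to some vertex of $B$. An $\ell$-partition of $G$ is a set $\beta$ of pairwise disjoint subsets of $V(G)$, each of size at most $\ell$, whose union is $V(G)$. It is $(c,d)$-disjointed if for every $(B_1,\dots,B_c)\in\beta^c$ and every connected component $X$ of $G-(B_1\cup\dots\cup B_c)$ there is $Q\subseteq V(X)$ with $|Q|\le d$ such that every connected component $Y$ of $X-Q$ satisfies $V(Y)\cap N_G(B_i')=\emptyset$ for some $i\in\{1,\dots,c\}$,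 where $B_i':=B_i\setminus(B_1\cup\dots\cup B_{i-1})$. *)

(* Defs.v *)
From Stdlib Require Import ClassicalDescription.
From HB Require Import structures.
From mathcomp Require Import all_boot.

Set Implicit Arguments.
Unset Strict Implicit.
Unset Printing Implicit Defensive.

Definition decP (P : nat -> Prop) : pred nat :=
  fun n => if excluded_middle_informative (P n) then true else false.

Lemma decP_ex (P : nat -> Prop) : (exists n, P n) -> exists n, decP P n.
Proof.
by move=> [n Pn]; exists n; rewrite /decP; case: excluded_middle_informative.
Qed.

(* least n with P n (0 if there is none; only used where a witness exists) *)
Definition nat_min (P : nat -> Prop) : nat :=
  match excluded_middle_informative (exists n, P n) with
  | left h => ex_minn (decP_ex h)
  | right _ => 0
  end.

Definition opt_min (P : nat -> Prop) : option nat :=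
  match excluded_middle_informative (exists n, P n) with
  | left h => Some (ex_minn (decP_ex h))
  | right _ => None
  end.

Record graph := Graph {
  gn : nat;
  gadj : rel 'I_gn;
  gsym : symmetric gadj;
  girr : irreflexive gadj }.
Arguments gadj : clear implicits.

Definition isomorphic (G H : graph) : Prop :=
  exists f : 'I_(gn G) -> 'I_(gn H),
    bijective f /\ forall u v, gadj H (f u) (f v) = gadj G u v.

Definition graph_class (C : graph -> Prop) : Prop :=
  forall G H, isomorphic G H -> C G -> C H.

Definition induced_rel (T : finType) (e : rel T) (S : {set T}) : rel T :=
  fun a b => [&& e a b, a \in S & b \in S].

(* vertex set of the connected component containing x of the subgraph
   induced on S (for x \in S) *)
Definition component (T : finType) (e : rel T) (S : {set T}) (x : T) : {set T} :=
  [set y | connect (induced_rel e S) x y].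

Definition acyclic (k : nat) (t : rel 'I_k) : Prop :=
  forall (x : 'I_k) (p : seq 'I_k),
    path t x p -> uniq (x :: p) -> 2 <= size p -> ~~ t (last x p) x.

Definition is_tree (k : nat) (t : rel 'I_k) : Prop :=
  [/\ 0 < k, symmetric t, irreflexive t,
      (forall x y, connect t x y) & acyclic t].

Definition tw_le (G : graph) (w : nat) : Prop :=
  exists (k : nat) (t : rel 'I_k) (B : 'I_k -> {set 'I_(gn G)}),
    [/\ is_tree t,
        (forall v, exists s, v \in B s),
        (forall u v, gadj G u v -> exists s, (u \in B s) && (v \in B s)),
        (forall v s1 s2, v \in B s1 -> v \in B s2 ->
            connect (induced_rel t [set s | v \in B s]) s1 s2)
      & forall s, #|B s| <= w.+1].

Definition tw (G : graph) : nat := nat_min (tw_le G).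

(* the partition is given by phi : V(G) -> V(H); V_x = phi^-1(x) *)
Definition Hpartition (G H : graph) (phi : 'I_(gn G) -> 'I_(gn H)) : Prop :=
  forall u v, gadj G u v -> phi u = phi v \/ gadj H (phi u) (phi v).

Definition Hpart_width_le (G H : graph) (phi : 'I_(gn G) -> 'I_(gn H)) (k : nat)
  : Prop := forall x, #|[set v | phi v == x]| <= k.

Definition tpw_le (c : nat) (G : graph) (k : nat) : Prop :=
  exists (H : graph) (phi : 'I_(gn G) -> 'I_(gn H)),
    [/\ tw H <= c, Hpartition phi & Hpart_width_le phi k].

Definition tpw (c : nat) (G : graph) : nat := nat_min (tpw_le c G).

(* underlying treewidth; None = unbounded *)
Definition underlying_tw (C : graph -> Prop) : option nat :=
  opt_min (fun c => exists f : nat -> nat,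
                      forall G, C G -> tpw c G <= f (tw G)).

Definition lpartition (G : graph) (l : nat) (beta : {set {set 'I_(gn G)}}) : Prop :=
  [/\ trivIset beta, cover beta = setT & forall B, B \in beta -> #|B| <= l].

Definition nbh (G : graph) (B : {set 'I_(gn G)}) : {set 'I_(gn G)} :=
  [set v | [exists u in B, gadj G u v]].

Definition disjointed (G : graph) (c d : nat) (beta : {set {set 'I_(gn G)}}) : Prop :=
  forall Bs : 'I_c -> {set 'I_(gn G)}, (forall i, Bs i \in beta) ->
    let U := \bigcup_(i < c) Bs i in
    forall x, x \notin U ->
      let X := component (gadj G) (~: U) x in
      exists Q : {set 'I_(gn G)},
        [/\ Q \subset X, #|Q| <= d &
            forall y, y \in X :\: Q ->
              exists i : 'I_c,
                component (gadj G) (X :\: Q) y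
                  :&: nbh (Bs i :\: \bigcup_(j < c | j < i) Bs j) = set0].

(* Main.v *)
Require Import Defs.
From Stdlib Require Import ClassicalDescription.
From HB Require Import structures.
From mathcomp Require Import all_boot zify.

(* A graph of treewidth at most k has an injective rank for which every frontier has at
   most k vertices, where the frontier of v consists of the vertices of smaller rank
   adjacent to the component of v among the vertices of rank at least that of v. Applied
   to H, this turns an H-partition into a disjointed partition.

   Conversely, given a disjointed partition, H is built one part at a time, together with
   a clique elimination order. Every component Z of the unassigned vertices sees at most c
   parts, pairwise adjacent in H, and boundedly many vertices of each. The next part,
   taken inside Z, contains the sets Q of all choices of blocks through which these c
   parts touch Z, so that each remaining piece loses at least one of the c parts. Balanced
   separators of G then enlarge the new part so that every remaining piece sees a number
   of its vertices independent of how large the part is. *)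

Set Implicit Arguments.
Unset Strict Implicit.
Unset Printing Implicit Defensive.

(** * Connected sets and components *)

Lemma connect_closed (T : finType) (r : rel T) (P : pred T) (x y : T) :
  (forall a b, P a -> r a b -> P b) -> P x -> connect r x y -> P y.
Proof.
move=> clP Px /connectP[p]; elim: p x Px => [|z p IHp] x Px /= => [_ ->//|].
by case/andP=> rxz pth lst; apply: IHp (clP _ _ Px rxz) pth lst.
Qed.

Section Connectedness.
Variables (T : finType) (e : rel T).
Hypothesis e_sym : symmetric e.
Implicit Types (S Z A : {set T}).

(** Connectivity as an induction principle: a property that holds at one vertex of Z and passes
    along the edges inside Z holds on all of Z. The empty set counts as connected. *)
Definition connected Z : Prop :=
  forall A x, x \in Z -> x \in A ->
    (forall a b, a \in A -> a \in Z -> b \in Z -> e a b -> b \in A) ->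
  Z \subset A.

Definition neighbours Z : {set T} := [set v | [exists u in Z, e u v]].

Lemma neighboursP Z v :
  reflect (exists2 u, u \in Z & e u v) (v \in neighbours Z).
Proof. by rewrite inE; apply: (iffP exists_inP). Qed.

Lemma neighboursS Z A : Z \subset A -> neighbours Z \subset neighbours A.
Proof.
move=> /subsetP sub; apply/subsetP=> v /neighboursP[u /sub uA euv].
by apply/neighboursP; exists u.
Qed.

Lemma induced_rel_sym S : symmetric (induced_rel e S).
Proof. by move=> a b; rewrite /induced_rel e_sym; congr andb; apply: andbC. Qed.

Lemma component_refl S x : x \in component e S x.
Proof. by rewrite inE connect0. Qed.

Lemma component_sub S x : x \in S -> component e S x \subset S.
Proof.
move=> xS; apply/subsetP=> y; rewrite inE.
by apply: connect_closed xS => a b _ /and3P[].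
Qed.

Lemma component_step S x a b :
  a \in component e S x -> a \in S -> b \in S -> e a b -> b \in component e S x.
Proof.
rewrite !inE => xa aS bS eab; apply: connect_trans xa _.
by apply: connect1; rewrite /induced_rel eab aS bS.
Qed.

Lemma component_eq S x y :
  y \in component e S x -> component e S y = component e S x.
Proof.
move=> yx; apply/setP=> z; rewrite !inE.
move: yx; rewrite inE => cxy.
by rewrite (same_connect (sym_connect_sym (@induced_rel_sym S)) cxy).
Qed.

Lemma connected_connect Z :
  {in Z &, forall x y, connect (induced_rel e Z) x y} -> connected Z.
Proof.
move=> cZ A x xZ xA clA; apply/subsetP=> y yZ.
suff: (y \in A) && (y \in Z) by case/andP.
apply: (connect_closed (P := fun y => (y \in A) && (y \in Z))) (cZ x y xZ yZ).
  by move=> a b /andP[aA aZ] /and3P[eab _ bZ]; rewrite bZ (clA a b).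
by rewrite xA.
Qed.

Lemma connected_sub_component S Z x :
  connected Z -> Z \subset S -> x \in Z -> Z \subset component e S x.
Proof.
move=> cZ /subsetP ZS xZ; apply: cZ (xZ) (component_refl _ _) _ => a b aC aZ bZ.
by apply: component_step => //; apply: ZS.
Qed.

Lemma connected_component S x : x \in S -> connected (component e S x).
Proof.
move=> xS A x0 x0C x0A clA; apply/subsetP=> y yC.
have := yC; rewrite -(component_eq x0C) inE => c0y.
suff: (y \in A) && (y \in component e S x) by case/andP.
apply: (connect_closed (P := fun y => (y \in A) && (y \in component e S x))) c0y.
  move=> a b /andP[aA aC] /and3P[eab aS bS].
  have bC := component_step aC aS bS eab.
  by rewrite bC (clA a b).
by rewrite x0A.
Qed.

Lemma connected_exit Z A x y :
  connected Z -> x \in Z -> x \in A -> y \in Z -> y \notin A ->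
  exists a b, [/\ a \in A, a \in Z, b \in Z, b \notin A & e a b].
Proof.
move=> cZ xZ xA yZ yA.
have [/exists_inP[a aA /exists_inP[b bZ /and3P[aZ bA eab]]]|no] :=
  boolP [exists a in A, [exists b in Z, [&& a \in Z, b \notin A & e a b]]].
  by exists a, b.
case/negP: yA; apply: (subsetP (cZ A x xZ xA _) y yZ) => a b aA aZ bZ eab.
apply: contraR no => bA; apply/exists_inP; exists a => //.
by apply/exists_inP; exists b => //; apply/and3P.
Qed.

(** * Elimination ranks and balanced separators *)

Definition descendants (r : T -> nat) (v : T) : {set T} :=
  component e [set u | r v <= r u] v.

Definition frontier (r : T -> nat) (v : T) : {set T} :=
  [set z in neighbours (descendants r v) | r z < r v].

(** When vertices are eliminated in order of decreasing rank, the frontier of v is its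
    neighbourhood, fill edges included, at the moment of its elimination. *)
Definition elimination_rank (r : T -> nat) (c : nat) : Prop :=
  injective r /\ forall v, #|frontier r v| <= c.

Lemma descendants_rank r v u : u \in descendants r v -> r v <= r u.
Proof.
have vS : v \in [set u | r v <= r u] by rewrite inE.
by move/(subsetP (component_sub vS)); rewrite inE.
Qed.

(** The descendants of v can be left only through its frontier: a neighbour of rank at least [r v]
    is itself a descendant. *)
Lemma connected_sub_descendants r v Z :
  connected Z -> [disjoint Z & frontier r v] ->
  forall x, x \in Z -> x \in descendants r v -> Z \subset descendants r v.
Proof.
move=> cZ dis x xZ xD; apply: (cZ _ x) => // a b aD aZ bZ eab.
apply: (component_step aD _ _ eab); first by rewrite inE descendants_rank.
rewrite inE leqNgt; apply/negP=> lt_bv.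
have: b \in frontier r v.
  by rewrite inE lt_bv andbT; apply/neighboursP; exists a.
by rewrite (disjointFr dis bZ).
Qed.

(** This replaces an arbitrary connected set by the descendants of a single vertex. *)
Lemma connected_rank_min r Z x :
  connected Z -> x \in Z ->
  exists2 m, m \in Z & (forall z, z \in Z -> r m <= r z) /\ Z \subset descendants r m.
Proof.
move=> cZ xZ; case: (arg_minnP r xZ) => m mZ min_m; exists m => //; split=> //.
by apply: connected_sub_component => //; apply/subsetP=> z zZ; rewrite inE min_m.
Qed.

(* Cut at the vertex of largest rank whose descendants hold more than half of R. *)
Lemma balanced_separator r k (R : {set T}) :
  elimination_rank r k ->
  exists2 C : {set T}, #|C| <= k.+1 &
    forall Z, connected Z -> [disjoint Z & C] -> 2 * #|Z :&: R| <= #|R|.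
Proof.
case=> r_inj fr_le; pose heavy Z := #|R| < 2 * #|Z :&: R|.
have heavyS Z A : Z \subset A -> heavy Z -> heavy A.
  move=> ZA; rewrite /heavy => /leq_trans; apply.
  by rewrite leq_mul2l /= subset_leq_card ?setSI.
have heavy0 Z : heavy Z -> exists x, x \in Z.
  move=> hZ; case: (set_0Vmem Z) => [Z0|[x xZ]]; last by exists x.
  by move: hZ; rewrite Z0 /heavy set0I cards0.
have [v0 hv0|nohv] := pickP (fun v => heavy (descendants r v)); last first.
  exists set0; rewrite ?cards0 // => Z cZ _; rewrite leqNgt; apply/negP => hZ.
  have [x xZ] := heavy0 _ hZ.
  have [m mZ [_ /heavyS/(_ hZ)]] := connected_rank_min r cZ xZ.
  by rewrite nohv.
case: (@arg_maxnP _ v0 (fun v => heavy (descendants r v)) r hv0) => v hv max_v.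
exists (v |: frontier r v).
  by rewrite cardsU1 -(add1n k) leq_add ?leq_b1.
move=> Z cZ dis; rewrite leqNgt; apply/negP => hZ.
(* Z and the descendants of v each hold more than half of R, so they meet. *)
have [x] : exists x, x \in Z :&: descendants r v.
  case: (set_0Vmem (Z :&: descendants r v)) => [I0|[x xI]]; last by exists x.
  have := subset_leq_card (subsetIr (Z :|: descendants r v) R).
  rewrite setIUl cardsU.
  have -> : (Z :&: R) :&: (descendants r v :&: R) = set0.
    by apply/setP=> y; have /setP/(_ y) := I0; rewrite !in_setI in_set0 => yI; rewrite andbACA yI.
  by rewrite cards0; move: hZ hv; rewrite /heavy; lia.
case/setIP=> xZ xD.
have ZD : Z \subset descendants r v.
  apply: (connected_sub_descendants cZ _ xZ xD).
  by apply: disjointWr dis; apply: subsetUr.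
(* The descendants of the lowest vertex m of Z are heavy, so [r m <= r v] by the choice of v. As m
   is a descendant of v, it equals v, which lies in the separator. *)
have [m mZ [_ /heavyS/(_ hZ) hm]] := connected_rank_min r cZ xZ.
have: r v <= r m by apply: descendants_rank; apply: (subsetP ZD).
have le_mv := max_v m hm; move=> le_vm.
have mv : m = v by apply: r_inj; lia.
by have := disjointFr dis mZ; rewrite mv !inE eqxx.
Qed.

End Connectedness.

(** * Rooted trees, and elimination ranks from tree decompositions *)

Section Trees.
Variables (k : nat) (t : rel 'I_k).
Hypothesis tree_t : is_tree t.

Let t_sym : symmetric t. Proof. by case: tree_t. Qed.

(** If a and b differed, a path between them avoiding s would close to a cycle through s. *)
Lemma acyclic_cut s a b :
  t s a -> t s b -> b \in component t [set~ s] a -> a = b.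
Proof.
case: tree_t => _ _ t_irr _ acyc tsa tsb; rewrite inE => /connectP[p pth lst].
case: (eqVneq a b) => // neq_ab; move: lst neq_ab.
case/shortenP: pth => q pth uniq_q _ def_b neq_ab; subst b.
have s_neq x : t s x -> x != s.
  by move=> tsx; apply: contraTneq tsx => ->; rewrite t_irr.
have [tq sq] : path t a q /\ s \notin a :: q.
  rewrite inE negb_or eq_sym s_neq //=.
  elim: q (a) pth {uniq_q tsb neq_ab} => //= y q IHq a' /andP[/and3P[tay _ yS] pth].
  have [-> sq] := IHq _ pth; rewrite tay inE negb_or sq andbT; split=> //.
  by move: yS; rewrite andbT !inE eq_sym.
have := acyc s (a :: q); rewrite /= tsa tq -/(uniq (s :: a :: q)) cons_uniq sq uniq_q.
rewrite (t_sym _ s) tsb; case: q neq_ab {pth uniq_q tsb tq sq} => [|y q _]; first by rewrite /= eqxx.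
by move=> /(_ isT isT isT).
Qed.

Definition depth_function (root : 'I_k) (d : 'I_k -> nat) : Prop :=
  forall x, x != root -> exists2 p, t x p & d p < d x.

(** The distance from the root works: the last step of a shortest walk to x comes from a node at
    smaller distance. *)
Lemma depth_function_exists : exists root d, depth_function root d.
Proof.
case: tree_t => k_gt0 _ _ conn_t _; pose root := Ordinal k_gt0; exists root.
pose P x n := exists p, [/\ path t root p, last root p = x & size p = n].
have /fin_all_exists[d dP] : forall x, exists n, P x n /\ forall m, P x m -> n <= m.
  move=> x; have /connectP[p pth lst] := conn_t root x.
  have exD : exists n, Defs.decP (P x) n by apply: decP_ex; exists (size p), p.
  have decE n : Defs.decP (P x) n -> P x n.
    by rewrite /Defs.decP; case: excluded_middle_informative.
  case: (ex_minnP exD) => n /decE Pn min_n; exists n; split=> // m Pm.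
  by apply: min_n; rewrite /Defs.decP; case: excluded_middle_informative.
exists d => x x_root; have [[p [pth lst sz]] _] := dP x.
case/lastP: p pth lst sz => [_ /= rx|p y]; first by rewrite rx eqxx in x_root.
rewrite rcons_path last_rcons size_rcons => /andP[pth tpy] yx sz; subst y.
exists (last root p); first by rewrite t_sym.
by rewrite -sz ltnS; apply: (dP _).2; exists p.
Qed.

(** Suppose s is not in S'. Then S' lies in one component of the tree minus s, and this component
    contains the root, because climbing from s', no deeper than s, never meets s. It also contains
    the parent p of s. Going from x to s inside S, one enters s from this component, hence from p,
    although s is highest in S. *)
Lemma highest_node_mem root d (S S' : {set 'I_k}) s s' x :
    depth_function root d -> connected t S -> connected t S' ->
    s \in S -> (forall y, y \in S -> d s <= d y) -> x \in S -> x \in S' ->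
    s' \in S' -> d s' <= d s ->
  s \in S'.
Proof.
move=> dF cS cS' sS min_s xS xS' s'S' le_d; apply: contraT => sS'.
pose K := component t [set~ s].
have neqs y : y \in S' -> y \in [set~ s].
  by move=> yS'; rewrite !inE; apply: contraNneq sS' => <-.
have rootK n y : d y <= n -> d y <= d s -> y != s -> root \in K y.
  elim: n y => [|n IHn] y le_n le_s ys.
    case: (eqVneq y root) => [->|/dF[p _ /leq_trans/(_ le_n)//]].
    exact: component_refl.
  case: (eqVneq y root) => [->|/dF[p typ lt_py]]; first exact: component_refl.
  have ps : p != s by apply: contraTneq (leq_trans lt_py le_s) => ->; rewrite ltnn.
  have pKy : p \in K y.
    by apply: component_step (component_refl _ _ _) _ _ typ; rewrite !inE.
  rewrite /K -(component_eq t_sym pKy); apply: (IHn p _ _ ps).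
    by rewrite -ltnS; apply: leq_trans le_n.
  exact: leq_trans (ltnW lt_py) le_s.
have s'_s : s' != s by have := neqs _ s'S'; rewrite !inE.
have rK' := rootK _ _ (leqnn _) le_d s'_s.
have root_s : s != root.
  have /subsetP/(_ _ rK') := component_sub t (neqs _ s'S').
  by rewrite !inE eq_sym.
have [p tsp lt_ps] := dF _ root_s.
have ps : p != s by apply: contraTneq lt_ps => ->; rewrite ltnn.
have rKp := rootK _ p (leqnn _) (ltnW lt_ps) ps.
have xK : x \in K s'.
  apply: (subsetP (connected_sub_component cS' _ s'S')) xS'.
  exact/subsetP.
have sKx : s \notin K s'.
  by apply/negP=> /(subsetP (component_sub t (neqs _ s'S'))); rewrite !inE eqxx.
have [a [b [aK aS bS bK tab]]] := connected_exit cS xS xK sS sKx.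
have aNs : a \in [set~ s] by apply: (subsetP (component_sub t (neqs _ s'S'))) aK.
have bs : b = s.
  apply: contraNeq bK => bs; apply: (component_step aK aNs _ tab).
  by rewrite !inE.
have ap : a = p.
  apply: (@acyclic_cut s) => //; first by rewrite t_sym -bs.
  rewrite (component_eq t_sym aK) -(component_eq t_sym rK') (component_eq t_sym rKp).
  exact: component_refl.
by have := leq_trans lt_ps (min_s _ aS); rewrite ap ltnn.
Qed.

End Trees.

(** Vertices are ranked by the depth of the highest node whose bag holds them. The frontier of v
    lies in the bag of that node and misses v itself, hence w rather than w + 1. *)
Lemma elimination_rank_of_tw_le (G : graph) (w : nat) :
  tw_le G w -> exists r, elimination_rank (gadj G) r w.
Proof.
case=> k [t [B [tree_t cov edge conn size_B]]].
have [root [d dF]] := depth_function_exists tree_t.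
pose nodes v := [set s | v \in B s].
have /fin_all_exists[top topP] : forall v, exists s,
    v \in B s /\ forall y, v \in B y -> d s <= d y.
  move=> v; have [s0 vs0] := cov v.
  by case: (@arg_minnP _ s0 (fun s => v \in B s) d vs0) => s vs min_s; exists s.
have c_nodes v : connected t (nodes v).
  by apply: connected_connect => x y; rewrite !inE => vx vy; apply: conn.
(* The index of v, being below n, only breaks ties. *)
pose n := gn G; pose r (v : 'I_n) := d (top v) * n + v.
have n_gt0 (v : 'I_n) : 0 < n by case: v => m; apply: leq_ltn_trans.
have r_div v : r v %/ n = d (top v).
  by rewrite divnMDl ?(n_gt0 v) // divn_small // addn0.
exists r; split=> [u v ruv|v].
  have := congr1 (fun m => m %% n) ruv; rewrite /r !modnMDl !modn_small //.
  exact: val_inj.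
have [v_top min_v] := topP v.
apply: leq_trans (_ : #|B (top v) :\ v| <= w); last first.
  by have := size_B (top v); rewrite (cardsD1 v) v_top.
apply/subset_leq_card/subsetP=> z; rewrite inE => /andP[/neighboursP[u uD euz] lt_zv].
rewrite in_setD1; apply/andP; split; first by apply: contraTneq lt_zv => ->; rewrite ltnn.
set D := descendants (gadj G) r v in uD.
have cD : connected (gadj G) D by apply: connected_component; rewrite ?inE //; apply: gsym.
have vD : v \in D by apply: component_refl.
(* The nodes whose bags meet D form a subtree, since adjacent vertices share a bag. Its highest node
   is [top v], as no vertex of D ranks below v. *)
pose S := [set s | [exists x in D, x \in B s]].
have cS : connected t S.
  move=> A s; rewrite inE => /exists_inP[x xD xs] sA clA.
  have nodesA y s1 : y \in D -> y \in B s1 -> s1 \in A -> nodes y \subset A.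
    move=> yD ys1 s1A; apply: (c_nodes y _ s1) => //; first by rewrite inE.
    move=> a b aA; rewrite !inE => ya yb; apply: clA => //; rewrite inE;
      by apply/exists_inP; exists y.
  have DA : D \subset [set y | nodes y \subset A].
    apply: (cD _ x) => //; first by rewrite inE; apply: nodesA xs sA.
    move=> a b; rewrite inE => aA aD bD eab; rewrite inE.
    have [s1 /andP[as1 bs1]] := edge _ _ eab.
    by apply: nodesA bs1 _ => //; apply: (subsetP aA); rewrite inE.
  apply/subsetP=> s1; rewrite inE => /exists_inP[y /(subsetP DA)].
  by rewrite inE => /subsetP yA ys1; apply: yA; rewrite inE.
have [s1 /andP[us1 zs1]] := edge _ _ euz.
have [z_top _] := topP z.
(* The nodes holding z meet this subtree in s1 and reach at least as high as [top v], because z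
   ranks below v. *)
suff: top v \in nodes z by rewrite inE.
apply: (highest_node_mem tree_t dF cS (c_nodes z) (s' := top z) (x := s1)); rewrite ?inE //.
- by apply/exists_inP; exists v.
- move=> y; rewrite inE => /exists_inP[x xD xy].
  have [_ min_x] := topP x; apply: leq_trans (min_x _ xy).
  by rewrite -!r_div leq_div2r // (descendants_rank xD).
- by apply/exists_inP; exists u.
- by rewrite -!r_div leq_div2r // ltnW.
Qed.

(** * Upper bounds on treewidth, from few vertices or from a clique order *)

Lemma tw_le_small (G : graph) (w : nat) : gn G <= w.+1 -> tw_le G w.
Proof.
move=> le_w; exists 1, (fun _ _ => false), (fun _ => setT); split=> //.
- by split=> // x y; rewrite !ord1 connect0.
- by move=> v; exists ord0; rewrite inE.
- by move=> u v _; exists ord0; rewrite !inE.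
- by move=> v s1 s2 _ _; rewrite !ord1 connect0.
- by move=> s; rewrite cardsT card_ord.
Qed.

Lemma tw_le_mono (G : graph) (w w' : nat) : w <= w' -> tw_le G w -> tw_le G w'.
Proof.
move=> le_w [k [t [B [? ? ? ? size_B]]]]; exists k, t, B; split=> // s.
by apply: leq_trans (size_B s) _; rewrite ltnS.
Qed.

Section CliqueOrder.
Variables (n : nat) (N : nat -> seq nat).
Hypothesis N_lt : forall i j, i < n -> j \in N i -> j < i.
Hypothesis N_clique :
  forall i j j', i < n -> j \in N i -> j' \in N i -> j < j' -> j \in N j'.

(** The parent is the last earlier neighbour. If there is none, the empty maximum is 0, which
    attaches i to vertex 0 and yields a tree instead of a forest. *)
Let parent i := \max_(j <- N i) j.

Let leq_parent i j : j \in N i -> j <= parent i.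
Proof. by move=> jN; apply: (@leq_bigmax_seq _ _ xpredT id). Qed.

Let parent_mem i j : j \in N i -> parent i \in N i.
Proof.
rewrite /parent; elim: (N i) j => // x s IHs j _; rewrite big_cons.
case: s IHs => [_|y s /(_ y (mem_head _ _)) mem_s]; first by rewrite big_nil maxn0 mem_head.
by rewrite /maxn; case: ifP => _; rewrite inE ?mem_s ?eqxx ?orbT.
Qed.

Let parent_lt i : 0 < i < n -> parent i < i.
Proof.
case/andP=> i_gt0 lt_in; case E: (N i) => [|j s]; first by rewrite /parent E big_nil.
by apply: (N_lt lt_in); apply: (@parent_mem i j); rewrite E mem_head.
Qed.

Let parent_le i : i < n -> parent i <= i.
Proof.
case: i => [|i] lt_in; last by rewrite ltnW // parent_lt.
rewrite leqn0 /parent; case E: (N 0) => [|j s]; first by rewrite big_nil.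
by have := @N_lt 0 j lt_in; rewrite E mem_head => /(_ isT).
Qed.

(** The test [x != y] removes the loop at 0, the only vertex that is its own parent. *)
Definition parent_rel : rel 'I_n :=
  fun x y => (x != y) && ((parent x == y) || (parent y == x)).

Let parent_rel_lt (x y : 'I_n) : parent_rel x y -> x < y -> parent y = x.
Proof.
case/andP=> _ /orP[/eqP xy|/eqP //] lt_xy.
by have := parent_le (ltn_ord x); rewrite xy leqNgt lt_xy.
Qed.

Let parent_rel_sym : symmetric parent_rel.
Proof. by move=> x y; rewrite /parent_rel eq_sym orbC. Qed.

Let parent_rel_step (x : 'I_n) : 0 < x ->
  exists y : 'I_n, [/\ val y = parent x, parent_rel x y & y < x].
Proof.
move=> x_gt0; have lt_px : parent x < x by rewrite parent_lt ?x_gt0 ?ltn_ord.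
exists (Ordinal (ltn_trans lt_px (ltn_ord x))); split=> //.
by rewrite /parent_rel /= eqxx andbT -val_eqE /= neq_ltn lt_px orbT.
Qed.

Lemma parent_rel_tree : 0 < n -> is_tree parent_rel.
Proof.
move=> n_gt0; split=> //.
- by move=> x; rewrite /parent_rel eqxx.
- pose root := Ordinal n_gt0.
  have to_root m (x : 'I_n) : x <= m -> connect parent_rel x root.
    elim: m x => [|m IHm] x le_xm; case: (posnP x) => [x0|x_gt0].
    + by rewrite (_ : x = root) ?connect0 //; apply: val_inj.
    + by move: le_xm; rewrite leqNgt x_gt0.
    + by rewrite (_ : x = root) ?connect0 //; apply: val_inj.
    have [y [_ xy lt_yx]] := parent_rel_step x_gt0.
    by apply: connect_trans (connect1 xy) (IHm _ _); rewrite -ltnS (leq_trans lt_yx).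
  move=> x y; apply: connect_trans (to_root _ _ (leqnn _)) _.
  by rewrite (sym_connect_sym parent_rel_sym) (to_root _ _ (leqnn _)).
(* The largest vertex of a cycle would have two distinct parents. *)
move=> x p pth uniq_p size_p; apply/negP => t_last.
have cyc : cycle parent_rel (x :: p) by rewrite /= rcons_path pth.
case: (@arg_maxnP _ x (fun y => y \in x :: p) val (mem_head _ _)) => m mp max_m.
have [i q def_q] := rot_to mp.
have cyc_q : cycle parent_rel (m :: q) by rewrite -def_q rot_cycle.
have uniq_q : uniq (m :: q) by rewrite -def_q rot_uniq.
have size_q : 2 <= size q.
  by have := congr1 size def_q; rewrite size_rot /= => -[<-].
have max_q y : y \in q -> y < m.
  move=> yq; have y_mq : y \in m :: q by rewrite inE yq orbT.
  have := max_m y; rewrite -(mem_rot i) def_q => /(_ y_mq) /= le_ym.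
  rewrite ltn_neqAle le_ym andbT; apply: contraTneq yq => /val_inj ->.
  by move: uniq_q; rewrite /= => /andP[].
case: q {def_q} cyc_q uniq_q size_q max_q => // a [//|b q].
rewrite /cycle -cat1s rcons_cat /= rcons_path => /and4P[tma _ _ tlm].
case/and3P=> _ a_bq _ _ max_q.
have pa := parent_rel_lt _ (max_q a (mem_head _ _)).
have lq : last b q \in [:: a, b & q] by rewrite inE mem_last orbT.
have pl := parent_rel_lt tlm (max_q _ lq).
case/negP: a_bq; have -> : a = last b q by apply: val_inj; rewrite /= -pl -pa // parent_rel_sym.
exact: mem_last.
Qed.

(** The bag of s is s with [N s]. If v is in [N s], then v is the parent of s or, [N s] being a
    clique, v is in the list of that parent. So climbing from s stays in bags holding v until v is
    reached. *)
Lemma parent_rel_connect (v s : 'I_n) : val v \in val s :: N s ->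
  connect (induced_rel parent_rel [set s : 'I_n | val v \in val s :: N s]) s v.
Proof.
set S := [set s : 'I_n | _].
have vS : v \in S by rewrite !inE eqxx.
have [m] := ubnP (val s); elim: m s => // m IHm s; rewrite ltnS => le_sm vs.
have sS : s \in S by rewrite inE.
move: vs; rewrite inE => /orP[/eqP/val_inj <-|vN]; first exact: connect0.
have lt_vs := N_lt (ltn_ord s) vN.
have [y [def_y sy lt_ys]] := parent_rel_step (leq_ltn_trans (leq0n _) lt_vs).
have yN : val y \in N s by rewrite def_y; apply: parent_mem vN.
have v_y : val v \in val y :: N y.
  have := leq_parent vN; rewrite -def_y leq_eqVlt inE => /orP[->//|lt_vy].
  by rewrite (N_clique (ltn_ord s) vN yN lt_vy) orbT.
apply: connect_trans (IHm y _ v_y); last by apply: leq_trans le_sm.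
by apply: connect1; rewrite /induced_rel sy sS inE.
Qed.

End CliqueOrder.

(** The lists describe a chordal supergraph of H whose vertices are eliminated in decreasing order;
    each bag is the clique of s and [N s]. *)
Lemma tw_le_of_clique_order (H : graph) (N : nat -> seq nat) (c : nat) :
    (forall i j, i < gn H -> j \in N i -> j < i) ->
    (forall i j j', i < gn H -> j \in N i -> j' \in N i -> j < j' -> j \in N j') ->
    (forall i, i < gn H -> size (N i) <= c) ->
    (forall u v, gadj H u v -> val u \in N v \/ val v \in N u) ->
  tw_le H c.
Proof.
move=> N_lt N_cl size_N N_adj.
have [n0|n_gt0] := posnP (gn H); first by apply: tw_le_small; rewrite n0.
exists (gn H), (parent_rel N), (fun s : 'I_(gn H) => [set v : 'I_(gn H) | val v \in val s :: N s]); split.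
- exact: parent_rel_tree.
- by move=> v; exists v; rewrite !inE eqxx.
- move=> u v /N_adj[uv|vu].
    by exists v; rewrite !inE uv eqxx orbT.
  by exists u; rewrite !inE vu eqxx orbT.
- move=> v s1 s2; rewrite !in_set => vs1 vs2.
  pose S := [set s : 'I_(gn H) | val v \in val s :: N s].
  rewrite (_ : [set s | _] = S); last by apply/setP=> s; rewrite !in_set.
  have to_v (s : 'I_(gn H)) : val v \in val s :: N s ->
    connect (induced_rel (parent_rel N) S) s v by apply: parent_rel_connect.
  apply: connect_trans (to_v s1 vs1) _.
  rewrite (sym_connect_sym (induced_rel_sym _ _)); first exact: to_v.
  by move=> x y; rewrite /parent_rel eq_sym orbC.
move=> s; apply: leq_trans (_ : size (val s :: N s) <= _); last by rewrite /= ltnS size_N.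
rewrite cardE -(size_map val); apply: uniq_leq_size.
  by rewrite map_inj_uniq ?enum_uniq //; apply: val_inj.
by move=> i /mapP[v]; rewrite mem_enum inE => ? ->.
Qed.

(** * From H-partitions to disjointed partitions *)

Lemma connected_imset (G H : graph) (phi : 'I_(gn G) -> 'I_(gn H)) Z :
  Hpartition phi -> connected (gadj G) Z -> connected (gadj H) (phi @: Z).
Proof.
move=> phiP cZ A _ /imsetP[x xZ ->] xA clA.
have /subsetP ZA : Z \subset phi @^-1: A.
  apply: (cZ _ x) => //; first by rewrite inE.
  move=> a b; rewrite !inE => aA aZ bZ eab.
  case: (phiP a b eab) => [<- //|ab]; apply: clA ab => //; exact: imset_f.
by apply/subsetP=> _ /imsetP[z /ZA zA ->]; rewrite inE in zA.
Qed.

Lemma card_preimset_le (aT rT : finType) (f : aT -> rT) (k : nat) (A : {set rT}) :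
  (forall x, #|[set v | f v == x]| <= k) -> #|f @^-1: A| <= #|A| * k.
Proof.
move=> size_f; apply: leq_trans (_ : #|cover [set f @^-1: [set x] | x in A]| <= _).
  apply/subset_leq_card/subsetP=> v; rewrite inE => vA.
  by apply/bigcupP; exists (f @^-1: [set f v]); rewrite ?imset_f // !inE.
apply: leq_trans (leq_card_cover _) _.
apply: leq_trans (_ : \sum_(B in [set f @^-1: [set x] | x in A]) k <= _).
  apply: leq_sum => _ /imsetP[x _ ->]; apply: leq_trans (size_f x).
  by apply/subset_leq_card/subsetP=> v; rewrite !inE.
by rewrite sum_nat_const leq_mul2r leq_imset_card orbT.
Qed.

(* Q collects the fibres over the frontiers of the chosen parts and over the
   lowest part met by X: a component of X - Q touching all the chosen parts
   would have c + 1 frontier vertices. *)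
Lemma disjointed_of_Hpartition (G H : graph) (phi : 'I_(gn G) -> 'I_(gn H)) (c k : nat) :
    tw_le H c -> Hpartition phi -> Hpart_width_le phi k ->
  exists beta : {set {set 'I_(gn G)}},
    lpartition k beta /\ disjointed c ((c * c).+1 * k) beta.
Proof.
move=> /elimination_rank_of_tw_le[r [r_inj fr_le]] phiP size_phi.
pose fibre x := [set v | phi v == x].
exists [set fibre x | x : 'I_(gn H)]; split.
  split=> [||_ /imsetP[x _ ->]]; last exact: size_phi.
    apply/trivIsetP=> _ _ /imsetP[x _ ->] /imsetP[y _ ->] neq_xy.
    rewrite -setI_eq0; apply/eqP/setP=> v; rewrite !inE.
    by apply: contraNF neq_xy => /andP[/eqP<- /eqP<-].
  apply/setP=> v; rewrite inE; apply/bigcupP.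
  by exists (fibre (phi v)); rewrite ?imset_f // inE.
move=> Bs BsP U x xU X.
have /fin_all_exists[xs xsP] : forall i, exists x, Bs i = fibre x.
  by move=> i; have /imsetP[z _ ->] := BsP i; exists z.
have G_sym := @gsym G; have H_sym := @gsym H.
have xUc : x \in ~: U by rewrite inE.
have X_sub : X \subset ~: U := component_sub _ xUc.
have cX : connected (gadj G) X := connected_component G_sym xUc.
have xs_notin v i : v \in X -> phi v != xs i.
  move=> /(subsetP X_sub); rewrite inE; apply: contraNneq => def_v.
  by apply/bigcupP; exists i; rewrite // xsP inE def_v.
have xX : x \in X by apply: component_refl.
have cphiX := connected_imset phiP cX.
have [_ /imsetP[x0 x0X ->] [min_x0 _]] := connected_rank_min r cphiX (imset_f phi xX).
(* There are c frontiers of at most c vertices each, and one further part: this is the factor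
   [(c * c).+1]. *)
pose A := phi x0 |: \bigcup_i frontier (gadj H) r (xs i).
have card_A : #|A| <= (c * c).+1.
  rewrite cardsU1 -add1n leq_add ?leq_b1 //.
  apply: leq_trans (_ : \sum_(i < c) c <= _); last by rewrite sum_nat_const card_ord.
  elim/big_ind2: _ => [|m S m' S' leS leS'|i _] //; first by rewrite cards0.
  by apply: leq_trans (leq_add leS leS'); rewrite cardsU leq_subr.
exists (X :&: phi @^-1: A); split; [exact: subsetIl | | ].
  apply: leq_trans (subset_leq_card (subsetIr _ _)) _.
  apply: leq_trans (card_preimset_le A size_phi) _.
  by rewrite leq_mul2r card_A orbT.
set Q := X :&: _; move=> y yXQ; set Y := component _ _ _.
have [i /eqP meet_i|meet] :=
  pickP (fun i => Y :&: nbh (Bs i :\: \bigcup_(j < c | j < i) Bs j) == set0).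
  by exists i.
exfalso.
have Y_sub : Y \subset X :\: Q := component_sub _ yXQ.
have cY : connected (gadj G) Y := connected_component G_sym yXQ.
have yY : y \in Y by apply: component_refl.
have YX v : v \in Y -> v \in X by move=> /(subsetP Y_sub)/setDP[].
have Y_notA v : v \in Y -> phi v \notin A.
  by move=> /(subsetP Y_sub)/setDP[vX]; apply: contra => vA; apply/setIP; split=> //; rewrite inE.
have cphiY := connected_imset phiP cY.
have [m mY [min_m sub_m]] := connected_rank_min r cphiY (imset_f phi yY).
have adj_xs i : exists2 v, v \in Y & gadj H (xs i) (phi v).
  have /negbT/set0Pn[v] := meet i.
  rewrite in_setI => /andP[vY]; rewrite inE => /exists_inP[u].
  rewrite in_setD xsP inE => /andP[_ /eqP def_u] euv; exists v => //.
  case: (phiP u v euv); rewrite def_u // => xs_v.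
  by have := xs_notin v i (YX v vY); rewrite -xs_v eqxx.
have m_notA : m \notin A by have /imsetP[v vY ->] := mY; apply: Y_notA.
have m_xs i : m != xs i by have /imsetP[v vY ->] := mY; apply/xs_notin/YX.
(* The image of Y is connected, adjacent to [xs i] and disjoint from its frontier, so it lies among
   the descendants of [xs i]. *)
have lt_xs i : r (xs i) < r m.
  have [v vY xs_v] := adj_xs i.
  have frA z : z \in frontier (gadj H) r (xs i) -> z \in A.
    by move=> zfr; apply/setUP; right; apply/bigcupP; exists i.
  have dis : [disjoint phi @: Y & frontier (gadj H) r (xs i)].
    rewrite disjoint_subset; apply/subsetP=> _ /imsetP[z zY ->].
    by rewrite inE; apply: contra (Y_notA z zY) => /frA.
  have vD : phi v \in descendants (gadj H) r (xs i).
    have xsD : xs i \in descendants (gadj H) r (xs i) by apply: component_refl.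
    have [lt_v|le_v] := ltnP (r (phi v)) (r (xs i)).
      have: phi v \in frontier (gadj H) r (xs i).
        by rewrite inE lt_v andbT; apply/neighboursP; exists (xs i).
      by rewrite (disjointFr dis (imset_f _ vY)).
    by apply: (component_step xsD _ _ xs_v); rewrite inE.
  have mD := subsetP (connected_sub_descendants cphiY dis (imset_f _ vY) vD) m mY.
  rewrite ltn_neqAle (descendants_rank mD) andbT.
  by apply: contraNneq (m_xs i) => /r_inj ->.
have x0Q : x0 \in Q by apply/setIP; split=> //; rewrite inE setU11.
have x0Y : x0 \notin Y by apply/negP=> /(subsetP Y_sub); rewrite in_setD x0Q.
(* An edge inside X leaves Y towards x0 and must end in Q. Its end b supplies the frontier vertex of
   m beyond the c chosen parts. *)
have [a [b [aY aX bX bY eab]]] := connected_exit cX (YX y yY) yY x0X x0Y.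
have bA : phi b \in A.
  apply: contraR bY => bA; have aXQ := subsetP Y_sub a aY.
  apply: (component_step aY aXQ _ eab); rewrite in_setD bX andbT.
  by apply: contra bA => /setIP[_]; rewrite inE.
have lt_b : r (phi b) < r m.
  case/setUP: (bA) => [/set1P->|/bigcupP[i _]].
    have /imsetP[v vY def_m] := mY.
    rewrite ltn_neqAle min_x0 ?def_m ?imset_f ?YX // andbT -def_m.
    by apply: contraNneq m_notA => /r_inj <-; rewrite !inE eqxx.
  by rewrite inE => /andP[_ lt_bi]; apply: ltn_trans lt_bi (lt_xs i).
(* A repeated part has nothing left once the earlier parts are removed, so Y could not touch it. *)
have xs_inj : injective xs.
  have xs_lt (i j : 'I_c) : j < i -> xs i != xs j.
    move=> lt_ji; apply/eqP=> xs_ij.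
    have /negbT/set0Pn[v] := meet i.
    rewrite in_setI => /andP[_]; rewrite inE => /exists_inP[u]; rewrite in_setD => /andP[/negP no_u ui].
    by case: no_u; apply/bigcupP; exists j; rewrite // xsP -xs_ij -xsP.
  move=> i j xs_ij; case: (ltngtP i j) => [/xs_lt|/xs_lt|/ord_inj //].
    by rewrite xs_ij eqxx.
  by rewrite xs_ij eqxx.
have: c.+1 <= #|frontier (gadj H) r m|.
  have <- : #|phi b |: [set xs i | i : 'I_c]| = c.+1.
    rewrite cardsU1 card_imset // card_ord.
    case: imsetP => // -[i _ b_xs]; by have := xs_notin b i bX; rewrite b_xs eqxx.
  apply/subset_leq_card/subsetP=> z; case/setU1P=> [->|/imsetP[i _ ->]].
    rewrite inE lt_b andbT; apply/neighboursP; exists (phi a).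
      exact: (subsetP sub_m) (imset_f phi aY).
    case: (phiP a b eab) => // ab.
    by have := Y_notA a aY; rewrite ab bA.
  rewrite inE lt_xs andbT; have [v vY xs_v] := adj_xs i.
  by apply/neighboursP; exists (phi v); rewrite 1?H_sym // (subsetP sub_m) ?imset_f.
by rewrite ltnNge fr_le.
Qed.

(** * Separators compatible with the blocks *)

Section BlockSeparator.
Variables (T : finType) (e : rel T) (r : T -> nat) (k l : nat) (b : T -> {set T}).
Hypotheses (e_sym : symmetric e) (r_elim : elimination_rank e r k).
Hypothesis b_size : forall v, #|[set u | b u == b v]| <= l.
Implicit Types (C R S W Y Z : {set T}).

Lemma card_bigcup_le (I : finType) (P : {set I}) (F : I -> {set T}) m :
  (forall i, i \in P -> #|F i| <= m) -> #|\bigcup_(i in P) F i| <= #|P| * m.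
Proof.
move=> leF; rewrite -sum_nat_const; apply: leq_trans (_ : \sum_(i in P) #|F i| <= _).
  elim/big_ind2: _ => [|m1 S1 m2 S2 le1 le2|i _] //; first by rewrite cards0.
  by apply: leq_trans (leq_add le1 le2); rewrite cardsU leq_subr.
exact: leq_sum.
Qed.

(** No vertex of Y left outside the saturation shares a block with a vertex inside it. *)
Definition saturation Y R : {set T} := \bigcup_(v in R) [set u in Y | b u == b v].

Lemma saturationP Y R u :
  reflect (u \in Y /\ exists2 v, v \in R & b u = b v) (u \in saturation Y R).
Proof.
apply: (iffP bigcupP) => [[v vR]|[uY [v vR buv]]].
  by rewrite inE => /andP[uY /eqP buv]; split=> //; exists v.
by exists v; rewrite // inE uY buv eqxx.
Qed.

Lemma card_saturation Y R : #|saturation Y R| <= #|R| * l.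
Proof.
apply: card_bigcup_le => v _; apply: leq_trans (b_size v).
by apply/subset_leq_card/subsetP=> u; rewrite !inE => /andP[].
Qed.

(** A recursive call keeps at most half of the boundary W and adds at most [k.+1 * l.+1] vertices;
    above twice that number, the boundary strictly shrinks. *)
Let M := 2 * (k.+1 * l.+1).

(** One saturated separator, then a recursive call for each piece meeting W, of which there are at
    most n. *)
Fixpoint separator_size n := if n is n'.+1 then k.+1 * l + n * separator_size n' else 0.

(* Only the blocks meeting both S and the boundary of Z are kept out of Z. Asking S
   to be a union of blocks of Y would be too much: a block may meet several pieces
   of the recursion. *)
Lemma block_separator n Y W : #|W| <= n -> [disjoint W & Y] ->
  exists S, [/\ S \subset Y, #|S| <= separator_size n &
    forall Z, connected e Z -> Z \subset Y :\: S ->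
      #|neighbours e Z :&: (W :|: S)| <= M /\
      (forall u v, u \in neighbours e Z -> u \in S -> v \in Z -> b u != b v)].
Proof.
elim: n Y W => [|n IHn] Y W.
  rewrite leqn0 cards_eq0 => /eqP-> _; exists set0; rewrite sub0set cards0; split=> // Z _ _.
  by rewrite setU0 setI0 cards0; split=> // u v _; rewrite inE.
move=> leW disWY; have [smallW|bigW] := leqP #|W| M.
  exists set0; rewrite sub0set cards0; split=> // Z _ _; rewrite setU0; split.
    by apply: leq_trans (subset_leq_card (subsetIr _ _)) smallW.
  by move=> u v _; rewrite inE.
have [C card_C bal] := balanced_separator W r_elim.
pose S0 := saturation Y (C :&: Y); pose CW := C :&: W.
have CY_S0 v : v \in C -> v \in Y -> v \in S0.
  by move=> vC vY; apply/saturationP; split=> //; exists v; rewrite // inE vC.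
have card_S0 : #|S0| <= k.+1 * l.
  apply: leq_trans (card_saturation _ _) _; rewrite leq_mul2r.
  by rewrite (leq_trans (subset_leq_card (subsetIl _ _)) card_C) orbT.
have card_CS0 : #|CW :|: S0| <= k.+1 * l.+1.
  rewrite mulnS; apply: leq_trans (_ : #|CW| + #|S0| <= _); first by rewrite cardsU leq_subr.
  by rewrite leq_add // (leq_trans (subset_leq_card (subsetIl _ _)) card_C).
(* W takes part in forming the pieces, so that the balance of C bounds its share in each of them. *)
pose base := (Y :|: W) :\: (C :|: S0).
pose piece w := component e base w.
have piece_base w : w \in base -> piece w \subset base := @component_sub _ e base w.
pose W_ w := (W :&: piece w) :|: (CW :|: S0); pose Y_ w := Y :&: piece w.
have baseP v : v \in Y -> v \notin S0 -> v \in base.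
  move=> vY vS0; rewrite !inE vY (negPf vS0) orbF /= andbT.
  by apply: contra vS0 => vC; apply: CY_S0.
(* The separator is chosen for the set K rather than for a vertex w, so that two vertices of one
   piece get the same separator. *)
have IHp : forall K, exists S, (exists2 w, w \in base & K = piece w) ->
    [/\ S \subset Y :&: K, #|S| <= separator_size n &
    forall Z, connected e Z -> Z \subset (Y :&: K) :\: S ->
      #|neighbours e Z :&: ((W :&: K) :|: (CW :|: S0) :|: S)| <= M /\
      (forall u v, u \in neighbours e Z -> u \in S -> v \in Z -> b u != b v)].
  move=> K; have [/exists_inP[w wb /eqP->]|noK] :=
    boolP [exists w in base, K == piece w]; last first.
    exists set0 => -[w wb defK]; case/negP: noK.
    by apply/exists_inP; exists w; rewrite ?defK.
  have [||S SP] := IHn (Y_ w) (W_ w); last by exists S.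
  - have: 2 * #|piece w :&: W| <= #|W|.
      apply: bal; first by apply: connected_component.
      rewrite disjoint_subset; apply/subsetP=> v /(subsetP (piece_base w wb)).
      by rewrite !inE negb_or => /andP[/andP[]].
    have := leq_trans (leq_card_setU (W :&: piece w) (CW :|: S0)) (leq_add (leqnn _) card_CS0).
    rewrite [W :&: _]setIC; move: bigW leW; rewrite /M /W_ setIC.
    set p := #|_ :&: _|; set q := _.+1 * _; set s := #|_ :|: _|; set w' := #|W|.
    by clear; lia.
  - rewrite disjoint_subset; apply/subsetP=> v vW; rewrite inE.
    apply/negP=> /setIP[vY vp]; case/setUP: vW => [/setIP[vW _]|/setUP[/setIP[_ vW]|vS0]].
    + by rewrite (disjointFr disWY vW) in vY.
    + by rewrite (disjointFr disWY vW) in vY.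
    + by have := subsetP (piece_base w wb) v vp; rewrite !inE vS0 orbT.
have [F FP] := fin_all_exists IHp.
have piece_eq w v : v \in piece w -> piece v = piece w := @component_eq _ e e_sym base w v.
(* A piece free of W is not cut further: connected sets in it see W and the separators only in
   [CW :|: S0]. *)
exists (S0 :|: \bigcup_(w in W :&: base) F (piece w)).
have FP_ w : w \in W :&: base -> _ := fun h => FP (piece w) (ex_intro2 _ _ w (subsetP (subsetIr _ _) w h) erefl).
split.
- rewrite subUset; apply/andP; split; first by apply/subsetP=> v /saturationP[].
  apply/bigcupsP=> w wWb; have [sub _ _] := FP_ w wWb.
  exact: subset_trans sub (subsetIl _ _).
- apply: leq_trans (leq_card_setU _ _) _; rewrite leq_add //.
  apply: leq_trans (card_bigcup_le (m := separator_size n) _) _.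
    by move=> w wWb; have [] := FP_ w wWb.
  by rewrite leq_mul2r (leq_trans (subset_leq_card (subsetIl _ _)) leW) orbT.
move=> Z cZ Z_sub.
have Z_base : Z \subset base.
  apply/subsetP=> v /(subsetP Z_sub)/setDP[vY]; rewrite in_setU negb_or => /andP[vS0 _].
  exact: baseP.
have ZY v : v \in Z -> v \in Y by move=> /(subsetP Z_sub)/setDP[].
have S0_sep u v : u \in S0 -> v \in Z -> b u != b v.
  move=> /saturationP[_ [w wC buw]] vZ; apply/eqP=> buv.
  have /setDP[vY] := subsetP Z_sub v vZ; rewrite in_setU negb_or => /andP[/negP vS0 _].
  by apply: vS0; apply/saturationP; split=> //; exists w; rewrite // -buv.
have Z_piece w u : u \in neighbours e Z -> u \in base -> u \in piece w -> Z \subset piece w.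
  move=> /neighboursP[z zZ ezu] ub up.
  rewrite -(piece_eq _ _ up); have zb := subsetP Z_base z zZ.
  have zu : z \in piece u.
    by apply: (component_step (component_refl _ _ _) ub zb); rewrite e_sym.
  by rewrite -(piece_eq _ _ zu); apply: connected_sub_component.
have F_base w u : w \in W :&: base -> u \in F (piece w) -> u \in base /\ u \in piece w.
  move=> wWb uF; have [sub _ _] := FP_ w wWb.
  have /setIP[_ up] := subsetP sub u uF; split=> //.
  by apply: subsetP up; apply: piece_base; case/setIP: wWb.
(* Outside [CW :|: S0], the neighbours of Z in W or in a recursive separator belong to [base], hence
   to the piece of Z. So only the call for that piece matters. *)
have [/exists_inP[w wWb Zw]|noW] := boolP [exists w in W :&: base, Z \subset piece w].
  have F_eq w' u : u \in neighbours e Z -> w' \in W :&: base -> u \in F (piece w') ->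
      u \in F (piece w).
    move=> uN wWb' uF; have [ub up] := F_base _ _ wWb' uF.
    have Zw' := Z_piece _ _ uN ub up; case/neighboursP: uN => z zZ _.
    by rewrite -(piece_eq w z (subsetP Zw z zZ)) (piece_eq w' z (subsetP Zw' z zZ)).
  have [_ _ /(_ Z cZ)[|bound sep]] := FP_ w wWb.
    apply/subsetP=> z zZ; rewrite in_setD in_setI ZY // (subsetP Zw) // !andbT.
    have /setDP[_] := subsetP Z_sub z zZ; apply: contra => zF; apply/setUP; right.
    by apply/bigcupP; exists w.
  split.
    apply: leq_trans bound; apply/subset_leq_card/subsetP=> u /setIP[uN uWS].
    rewrite in_setI uN; case/setUP: uWS => [uW|/setUP[uS0|/bigcupP[w' wWb' uF]]].
    + have [uC|uC] := boolP (u \in C); first by rewrite !in_setU in_setI [_ \in CW]inE uC uW orbT.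
      have [uS0|uS0] := boolP (u \in S0); first by rewrite !in_setU uS0 !orbT.
      have ub : u \in base by rewrite in_setD !in_setU negb_or uC uS0 uW orbT.
      have Zu := Z_piece u u uN ub (component_refl _ _ _).
      have up : u \in piece w.
        case/neighboursP: uN => z zZ _.
        rewrite -(piece_eq w z (subsetP Zw z zZ)) (piece_eq u z (subsetP Zu z zZ)).
        exact: component_refl.
      by rewrite !in_setU in_setI uW up.
    + by rewrite !in_setU uS0 !orbT.
    + by rewrite in_setU (F_eq w') ?orbT.
  move=> u v uN /setUP[uS0|/bigcupP[w' wWb' uF]] vZ; first exact: S0_sep.
  by apply: sep; rewrite ?(F_eq w').
have noF u w : u \in neighbours e Z -> w \in W :&: base -> u \in F (piece w) -> False.
  move=> uN wWb uF; have [ub up] := F_base _ _ wWb uF.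
  by case/exists_inP: noW; exists w; rewrite ?(Z_piece w u).
split; last by move=> u v uN /setUP[uS0|/bigcupP[w wWb /(noF u w uN wWb)//]]; apply: S0_sep.
apply: leq_trans (_ : k.+1 * l.+1 <= _); last by rewrite /M mul2n -addnn leq_addr.
apply: leq_trans card_CS0; apply/subset_leq_card/subsetP=> u /setIP[uN].
case/setUP=> [uW|/setUP[uS0|/bigcupP[w wWb /(noF u w uN wWb)//]]]; last first.
  by rewrite in_setU uS0 orbT.
have [uC|uC] := boolP (u \in C); first by rewrite in_setU in_setI uC uW.
have [uS0|uS0] := boolP (u \in S0); first by rewrite in_setU uS0 orbT.
have ub : u \in base by rewrite in_setD !in_setU negb_or uC uS0 uW orbT.
case/exists_inP: noW; exists u; first by rewrite in_setI uW.
exact: Z_piece ub (component_refl _ _ _).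
Qed.

End BlockSeparator.

(** * From disjointed partitions to H-partitions *)

Lemma leq_foldr_muln (M : nat) (s : seq nat) :
  {in s, forall x, x <= M} -> foldr muln 1 s <= M ^ size s.
Proof.
elim: s => //= x s IHs leM; rewrite expnS leq_mul ?leM ?mem_head //.
by apply: IHs => y ys; apply: leM; rewrite inE ys orbT.
Qed.

Section PartitionOfDisjointed.
Variables (G : graph) (c k l d : nat) (beta : {set {set 'I_(gn G)}}).
Hypotheses (tw_G : tw_le G k) (beta_l : lpartition l beta).
Hypothesis beta_d : disjointed c d beta.

Let T := 'I_(gn G).
Let e : rel T := gadj G.
Let b : T -> {set T} := pblock beta.
Let e_sym : symmetric e := @gsym G.

Let block_eq u v : (u \in b v) = (b u == b v).
Proof.
case: beta_l => triv cov _; rewrite eq_sym eq_pblock //.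
by rewrite cov inE.
Qed.

Let block_mem v : b v \in beta.
Proof. by case: beta_l => _ cov _; apply: pblock_mem; rewrite cov inE. Qed.

Let block_size v : #|[set u | b u == b v]| <= l.
Proof.
case: beta_l => _ _ size_beta; apply: leq_trans (size_beta _ (block_mem v)).
by apply/subset_leq_card/subsetP=> u; rewrite inE block_eq.
Qed.

Definition contact_bound := 2 * (k.+1 * l.+1).
(** There are at most [contact_bound ^ c] choices of contact vertices, each with a set Q of at most
    d vertices. The successor counts the new vertex z, and the factor l pays for completing
    blocks. *)
Definition part_seed := (contact_bound ^ c * d).+1 * l.
Definition part_bound := part_seed + separator_size k l part_seed.
Let M := contact_bound.

Implicit Types (Z U R : {set T}) (p : T -> nat) (N : nat -> seq nat) (L : seq nat).

Definition boundary U Z : {set T} := neighbours e Z :&: U.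

(** L contains all parts that Z sees. [live_sep] and [live_cross] make disjointedness applicable to
    the blocks of boundary vertices taken one from each part. *)
Record live U m p N Z L : Prop := Live {
  live_uniq : uniq L;
  live_size : size L <= c;
  live_lt : forall j, j \in L -> j < m;
  live_clique : forall j j', j \in L -> j' \in L -> j < j' -> j \in N j';
  live_mem : forall u, u \in boundary U Z -> p u \in L;
  live_contact : forall j, #|[set u in boundary U Z | p u == j]| <= M;
  live_sep : forall u v, u \in boundary U Z -> v \in Z -> b u != b v;
  live_cross : forall u v, u \in boundary U Z -> v \in boundary U Z ->
    p u != p v -> b u != b v }.

(* The vertices of U have been distributed over the parts 0, ..., m - 1. N i lists the
   earlier neighbours of part i in the quotient. A connected set outside U sees at most c
   parts, and few vertices of each. *)
Record partial_partition U m p N : Prop := PartialPartition {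
  pp_lt : forall v, v \in U -> p v < m;
  pp_size : forall i, #|[set v in U | p v == i]| <= part_bound;
  pp_nbr_lt : forall i j, i < m -> j \in N i -> j < i;
  pp_clique : forall i j j', i < m -> j \in N i -> j' \in N i -> j < j' -> j \in N j';
  pp_nbr_size : forall i, i < m -> size (N i) <= c;
  pp_adj : forall u v, u \in U -> v \in U -> e u v ->
    [\/ p u = p v, p u \in N (p v) | p v \in N (p u)];
  pp_live : forall Z, connected e Z -> Z \subset ~: U -> exists L, live U m p N Z L }.

Lemma boundaryS U Z Z' : Z' \subset Z -> boundary U Z' \subset boundary U Z.
Proof. by move=> sub; apply/setSI/neighboursS. Qed.

Lemma partial_partition0 :
  partial_partition set0 0 (fun _ => 0) (fun _ => [::]).
Proof.
split=> // [v|i|u v|Z _ _]; rewrite ?inE //.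
  by rewrite (_ : [set _ in _ | _] = set0) ?cards0 //; apply/setP=> v; rewrite !inE.
have bd0 : boundary set0 Z = set0 by apply: setI0.
exists [::]; split=> // [u|j|u v]; rewrite bd0 ?inE //.
by rewrite (_ : [set _ in _ | _] = set0) ?cards0 //; apply/setP=> v; rewrite !inE.
Qed.

(** By [live_sep], Z lies in one component X left by the blocks of the [h i], and the set Q for X
    serves. By [live_cross], [h i] is in no earlier block, so a piece avoiding the neighbourhood of
    the i-th reduced block is not adjacent to [h i]. *)
Lemma disjointed_tuple U m p N Z L z (h : 'I_c -> T) :
    connected e Z -> z \in Z -> live U m p N Z L ->
    size L = c -> (forall i, h i \in boundary U Z /\ p (h i) = nth 0 L i) ->
  exists Q : {set T}, #|Q| <= d /\
    forall Z', connected e Z' -> Z' != set0 -> Z' \subset Z :\: Q ->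
      exists i, h i \notin neighbours e Z'.
Proof.
move=> cZ zZ liveZ size_L hP; set UB := \bigcup_(i < c) b (h i).
have Z_UB : Z \subset ~: UB.
  apply/subsetP=> v vZ; rewrite inE; apply/negP=> /bigcupP[i _].
  rewrite block_eq eq_sym; apply/negP; apply: (live_sep liveZ) vZ; exact: (hP i).1.
have zUB : z \notin UB by have := subsetP Z_UB z zZ; rewrite inE.
have [Q [_ card_Q QP]] := beta_d (fun i => block_mem (h i)) zUB.
exists Q; split=> // Z' cZ' /set0Pn[y yZ'] Z'_sub.
set X := component _ _ _ in QP.
have ZX : Z \subset X by apply: connected_sub_component.
have Z'XQ : Z' \subset X :\: Q by apply: subset_trans Z'_sub (setSD _ ZX).
have [i Yi] := QP y (subsetP Z'XQ y yZ'); exists i.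
have Z'Y := connected_sub_component cZ' Z'XQ yZ'.
apply/negP=> /neighboursP[v vZ' evh].
have /setP/(_ v) := Yi; rewrite in_set0 in_setI (subsetP Z'Y) //=.
rewrite inE => /negbT/negP; apply; apply/exists_inP; exists (h i); last by rewrite gsym.
rewrite in_setD block_eq eqxx andbT; apply/negP=> /bigcupP[j lt_ji].
rewrite block_eq; apply/negP; apply: (live_cross liveZ); try exact: (hP _).1.
rewrite (hP i).2 (hP j).2 nth_uniq ?size_L ?ltn_ord ?(live_uniq liveZ) //.
by rewrite gtn_eqF.
Qed.

(** If L has c parts, the union of the sets Q over all choices of one boundary vertex per part is
    removed. A list shorter than c already serves for every piece. *)
Lemma detaching_set U m p N Z L z :
    connected e Z -> z \in Z -> live U m p N Z L ->
  exists Q : {set T}, #|Q| <= M ^ c * d /\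
    forall Z', connected e Z' -> Z' != set0 -> Z' \subset Z :\: Q ->
      exists L', [/\ uniq L', {subset L' <= L}, size L' < c &
        forall u, u \in boundary U Z' -> p u \in L'].
Proof.
move=> cZ zZ liveZ; have := live_size liveZ; rewrite leq_eqVlt => /orP[/eqP size_L|lt_L].
  pose F (i : 'I_c) := [set u in boundary U Z | p u == nth 0 L i].
  have /fin_all_exists[Q QP] : forall h : {ffun 'I_c -> T}, exists Q : {set T},
      h \in family (fun i => mem (F i)) -> #|Q| <= d /\
      forall Z', connected e Z' -> Z' != set0 -> Z' \subset Z :\: Q ->
        exists i, h i \notin neighbours e Z'.
    move=> h; have [hF|] := boolP (h \in _); last by exists set0.
    have [|Q QP] := disjointed_tuple (h := h) cZ zZ liveZ size_L; last by exists Q.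
    by move=> i; have /familyP/(_ i) := hF; rewrite inE => /andP[? /eqP].
  pose tuples := [set h : {ffun 'I_c -> T} | h \in family (fun i => mem (F i))].
  exists (\bigcup_(h in tuples) Q h); split.
    apply: leq_trans (card_bigcup_le (m := d) _) _.
      by move=> h; rewrite inE => /QP[].
    rewrite leq_mul2r cardsE card_family; apply/orP; right.
    apply: leq_trans (leq_foldr_muln _) _.
      by move=> _ /mapP[i _ ->]; apply: (live_contact liveZ).
    by rewrite size_map -cardE card_ord.
  move=> Z' cZ' nZ' sub.
  have [/existsP[i no_i]|] :=
    boolP [exists i : 'I_c, [forall u in boundary U Z', p u != nth 0 L i]].
    have iL : nth 0 L i \in L by rewrite mem_nth // size_L.
    exists (rem (nth 0 L i) L); split.
    - exact: rem_uniq (live_uniq liveZ).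
    - exact: mem_rem.
    - by rewrite size_rem // size_L ltn_predL (leq_ltn_trans _ (ltn_ord i)).
    move=> u uZ'; rewrite mem_rem_uniq ?(live_uniq liveZ) // inE.
    rewrite (implyP (forallP no_i u)) //= (live_mem liveZ) //.
    by apply: (subsetP (boundaryS _ _)) uZ'; apply: subset_trans sub (subsetDl _ _).
  rewrite negb_exists => /forallP no.
  (* If Z' still touched all c parts, its own contact vertices would be one of the choices, and the
     Q of that choice would have cut one of them off. *)
  have /fin_all_exists[h hP] : forall i : 'I_c, exists u,
      u \in boundary U Z' /\ p u == nth 0 L i.
    move=> i; have := no i; rewrite negb_forall_in => /exists_inP[u uZ' pu].
    by exists u; rewrite uZ'; case: eqP pu.
  have hF : [ffun i => h i] \in tuples.
    rewrite inE; apply/familyP=> i; rewrite ffunE inE (hP i).2 andbT.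
    by apply: (subsetP (boundaryS _ _)) (hP i).1; apply: subset_trans sub (subsetDl _ _).
  have [|_ /(_ Z' cZ' nZ')[|i]] := QP [ffun i => h i].
  - by move: hF; rewrite inE.
  - by apply: subset_trans sub _; apply/setDS/bigcup_sup.
  by rewrite ffunE; have [/setIP[-> _] _] := hP i.
exists set0; rewrite cards0; split=> // Z' _ _ sub; exists L; split=> //.
  exact: live_uniq liveZ.
move=> u uZ'; apply: (live_mem liveZ); apply: (subsetP (boundaryS _ _)) uZ'.
by apply: subset_trans sub (subsetDl _ _).
Qed.

(** The seed R0, made of z, the detaching set and their blocks inside Z, makes every piece lose a
    part. Enlarging it by S preserves this, since the property passes to smaller pieces, and limits
    the contact of each piece with the new part. *)
Lemma next_part U m p N Z L z :
    connected e Z -> z \in Z -> live U m p N Z L ->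
  exists R : {set T}, [/\ z \in R, R \subset Z, #|R| <= part_bound &
    forall Z', connected e Z' -> Z' \subset Z :\: R ->
      [/\ #|neighbours e Z' :&: R| <= M,
          (forall u v, u \in neighbours e Z' -> u \in R -> v \in Z' -> b u != b v) &
          exists L', [/\ uniq L', {subset L' <= L}, size L' < c \/ Z' = set0 &
            forall u, u \in boundary U Z' -> p u \in L']]].
Proof.
move=> cZ zZ liveZ; have [Q [card_Q QP]] := detaching_set cZ zZ liveZ.
have [r r_elim] := elimination_rank_of_tw_le tw_G.
pose R0 := saturation b Z (z |: Q).
have card_R0 : #|R0| <= part_seed.
  apply: leq_trans (card_saturation block_size _ _) _.
  by rewrite leq_mul2r cardsU1 -add1n leq_add ?leq_b1 ?orbT.
have R0Z : R0 \subset Z by apply/subsetP=> v /saturationP[].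
have disR0 : [disjoint R0 & Z :\: R0].
  by rewrite disjoint_sym disjoints_subset setDE subsetIr.
(* With R0 as the boundary W, the contact with all of [R0 :|: S] is at most M, whatever the size of
   R0. *)
have [S [S_sub card_S SP]] := block_separator e_sym r_elim block_size card_R0 disR0.
exists (R0 :|: S); split.
- by apply/setUP; left; apply/saturationP; split=> //; exists z; rewrite ?setU11.
- by rewrite subUset R0Z (subset_trans S_sub (subsetDl _ _)).
- by apply: leq_trans (leq_card_setU _ _) _; rewrite leq_add.
move=> Z' cZ' sub; have [|contact sep] := SP Z' cZ'; first by rewrite setDDl.
split=> //.
  move=> u v uN /setUP[/saturationP[uZ [w wQ buw]]|uS] vZ'; last exact: sep.
  have /setDP[vZ] := subsetP sub v vZ'; rewrite in_setU negb_or => /andP[/negP vR0 _].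
  apply/eqP=> buv; apply: vR0; apply/saturationP; split=> //; exists w => //.
  by rewrite -buv.
(* The empty set is connected too, and for c = 0 no list is shorter than c; hence the alternative
   [Z' = set0]. *)
have [->|nZ'] := eqVneq Z' set0.
  exists [::]; split=> //; first by right.
  by move=> u /setIP[/neighboursP[v]]; rewrite inE.
have [|L' [uL' subL' size_L' memL']] := QP Z' cZ' nZ'; last first.
  by exists L'; split=> //; left.
apply/subsetP=> v /(subsetP sub)/setDP[vZ vR]; rewrite in_setD vZ andbT.
apply: contra vR => vQ; apply/setUP; left; apply/saturationP; split=> //.
by exists v; rewrite // inE vQ orbT.
Qed.

(** R becomes part m, with the list L of its component Z as earlier neighbours. A set remaining
    inside Z sees m and fewer than c older parts, so at most c in all; a set outside Z is not
    adjacent to R and keeps its list. *)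
Lemma partial_partition_step U m p N z :
    partial_partition U m p N -> z \notin U ->
  exists U' m' p' N', partial_partition U' m' p' N' /\ U \proper U'.
Proof.
move=> pp zU; have zUc : z \in ~: U by rewrite inE.
pose Z := component e (~: U) z.
have cZ : connected e Z := connected_component e_sym zUc.
have ZU : Z \subset ~: U := component_sub e zUc.
have zZ : z \in Z := component_refl _ _ _.
have [L liveZ] := pp_live pp cZ ZU.
have [R [zR RZ card_R RP]] := next_part cZ zZ liveZ.
have RU v : v \in R -> v \notin U.
  by move=> /(subsetP RZ)/(subsetP ZU); rewrite inE.
pose p' v := if v \in R then m else p v; pose N' i := if i == m then L else N i.
have p'R v : v \in R -> p' v = m by rewrite /p' => ->.
have p'U v : v \in U -> p' v = p v.
  by move=> vU; rewrite /p' ifN //; apply: contraL vU; apply: RU.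
have N'm : N' m = L by rewrite /N' eqxx.
have N'lt i : i < m -> N' i = N i by rewrite /N' => /ltn_eqF->.
have adjZ u v : v \in Z -> u \in U -> e v u -> u \in boundary U Z.
  by move=> vZ uU evu; rewrite in_setI uU andbT; apply/neighboursP; exists v.
exists (U :|: R), m.+1, p', N'; split; last first.
  rewrite properE subsetUl; apply/subsetPn; exists z => //.
  by rewrite inE zR orbT.
split.
- move=> v /setUP[vU|vR]; last by rewrite p'R.
  by rewrite p'U // ltnS ltnW // (pp_lt pp).
- move=> i; have [->|neq_im] := eqVneq i m.
    apply: leq_trans card_R; apply/subset_leq_card/subsetP=> v; rewrite inE.
    by case/andP=> /setUP[vU|//]; rewrite p'U // ltn_eqF // (pp_lt pp).
  apply: leq_trans (pp_size pp i); apply/subset_leq_card/subsetP=> v; rewrite !inE.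
  case/andP=> /orP[vU|vR]; first by rewrite p'U // vU.
  by rewrite p'R // eq_sym (negPf neq_im).
- move=> i j; rewrite ltnS leq_eqVlt => /orP[/eqP->|lt_im].
    by rewrite N'm; apply: (live_lt liveZ).
  by rewrite N'lt //; apply: (pp_nbr_lt pp).
- move=> i j j'; rewrite ltnS leq_eqVlt => /orP[/eqP->|lt_im].
    rewrite N'm => jL j'L; rewrite N'lt ?(live_lt liveZ) //.
    exact: (live_clique liveZ).
  rewrite N'lt // => jN j'N; rewrite N'lt; first exact: (pp_clique pp lt_im).
  exact: ltn_trans (pp_nbr_lt pp lt_im j'N) lt_im.
- move=> i; rewrite ltnS leq_eqVlt => /orP[/eqP->|lt_im].
    by rewrite N'm; apply: (live_size liveZ).
  by rewrite N'lt //; apply: (pp_nbr_size pp).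
- have adjR u v : u \in U -> v \in R -> e v u -> p' u \in N' (p' v).
    move=> uU vR evu; rewrite (p'R v) // (p'U u) // N'm (live_mem liveZ) //.
    exact: adjZ (subsetP RZ v vR) uU evu.
  move=> u v /setUP[uU|uR] /setUP[vU|vR] euv.
  + by rewrite !p'U // !N'lt ?(pp_lt pp) //; apply: (pp_adj pp).
  + by constructor 2; apply: adjR; rewrite // e_sym.
  + by constructor 3; apply: adjR.
  + by constructor 1; rewrite !p'R.
move=> Z' cZ'; rewrite setCU subsetI => /andP[Z'U Z'R].
have [/exists_inP[x xZ' xZ]|noZ] := boolP [exists x in Z', x \in Z].
  have Z'Z : Z' \subset Z.
    by rewrite /Z -(component_eq e_sym xZ); apply: connected_sub_component.
  have bdZ := boundaryS U Z'Z.
  have [|contact sep [L' [uL' subL' size_L' memL']]] := RP Z' cZ'.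
    by rewrite setDE subsetI Z'Z.
  have {}size_L' : size L' < c by case: size_L' => // Z'0; rewrite Z'0 inE in xZ'.
  have L'lt j : j \in L' -> j < m by move=> /subL' /(live_lt liveZ).
  have bdP u : u \in boundary (U :|: R) Z' ->
      u \in boundary U Z' \/ u \in R /\ u \in neighbours e Z'.
    by move=> /setIP[uN /setUP[uU|uR]]; [left; apply/setIP | right].
  have bdU u : u \in boundary U Z' -> u \in U by case/setIP.
  exists (m :: L'); split=> //.
  + by rewrite /= uL' andbT; apply/negP=> /L'lt; rewrite ltnn.
  + by move=> j; rewrite inE => /orP[/eqP->//|/L'lt/ltnW].
  + move=> j j'; rewrite !inE => /orP[/eqP->|jL'] /orP[/eqP->|j'L'].
    * by rewrite ltnn.
    * by move=> lt_mj; have := ltn_trans lt_mj (L'lt _ j'L'); rewrite ltnn.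
    * by rewrite N'm subL'.
    * by rewrite N'lt ?L'lt //; apply: (live_clique liveZ); apply: subL'.
  + move=> u /bdP[uZ'|[uR _]]; last by rewrite p'R ?mem_head.
    by rewrite p'U ?inE ?memL' ?orbT // bdU.
  + move=> j; have [->|neq_jm] := eqVneq j m.
      apply: leq_trans contact; apply/subset_leq_card/subsetP=> u; rewrite inE.
      case/andP=> /bdP[uZ'|[uR uN] _]; last by apply/setIP.
      by rewrite p'U ?ltn_eqF ?(pp_lt pp) ?bdU.
    apply: leq_trans (live_contact liveZ j); apply/subset_leq_card/subsetP=> u.
    rewrite inE => /andP[/bdP[uZ'|[uR _]]]; last by rewrite p'R // eq_sym (negPf neq_jm).
    by rewrite p'U ?bdU // => pu; rewrite inE pu andbT (subsetP bdZ).
  + move=> u v /bdP[uZ'|[uR uN]] vZ'; last exact: sep.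
    by apply: (live_sep liveZ); [apply: (subsetP bdZ) | apply: (subsetP Z'Z)].
  (* A boundary vertex in U and one in R lie in different blocks because R is inside Z, and
     [live_sep] separates Z from its boundary in U. *)
  + move=> u v /bdP[uZ'|[uR uN]] /bdP[vZ'|[vR vN]].
    * rewrite !p'U ?bdU //; apply: (live_cross liveZ); exact: (subsetP bdZ).
    * move=> _; apply: (live_sep liveZ); [exact: (subsetP bdZ) | exact: (subsetP RZ)].
    * rewrite [b u == _]eq_sym => _.
      apply: (live_sep liveZ); [exact: (subsetP bdZ) | exact: (subsetP RZ)].
    * by rewrite !p'R ?eqxx.
have [L0 liveZ'] := pp_live pp cZ' Z'U.
(* A vertex of R adjacent to Z' would put a vertex of Z' into Z. *)
have bdE : boundary (U :|: R) Z' = boundary U Z'.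
  apply/setP=> u; rewrite !in_setI; apply: andb_id2l => /neighboursP[v vZ' evu].
  rewrite in_setU; case uR: (u \in R); rewrite ?orbT ?orbF //.
  case/exists_inP: noZ; exists v => //.
  apply: (component_step (subsetP RZ u uR)); rewrite 1?e_sym //.
    by rewrite inE RU.
  exact: (subsetP Z'U).
have bdU u : u \in boundary U Z' -> u \in U by case/setIP.
exists L0; split; rewrite ?bdE.
- exact: live_uniq liveZ'.
- exact: live_size liveZ'.
- by move=> j /(live_lt liveZ')/ltnW.
- move=> j j' jL j'L; rewrite N'lt ?(live_lt liveZ') //; exact: (live_clique liveZ').
- by move=> u uZ'; rewrite p'U ?bdU // (live_mem liveZ').
- move=> j; apply: leq_trans (live_contact liveZ' j); apply/subset_leq_card/subsetP=> u.
  by rewrite !inE => /andP[uZ']; rewrite uZ' p'U //; case/andP: uZ'.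
- exact: live_sep liveZ'.
- by move=> u v uZ' vZ'; rewrite !p'U ?bdU //; apply: (live_cross liveZ').
Qed.

Lemma partial_partition_full : exists m p N, partial_partition setT m p N.
Proof.
suff: forall n U m p N, #|~: U| <= n -> partial_partition U m p N ->
    exists m p N, partial_partition setT m p N.
  by move=> /(_ _ _ _ _ _ (leqnn _) partial_partition0).
elim=> [|n IHn] U m p N.
  rewrite leqn0 cards_eq0 => /eqP U0 pp; exists m, p, N.
  by rewrite -[setT](setCK setT) setCT -U0 setCK.
have [UT|[z zU]] := set_0Vmem (~: U).
  by move=> _ pp; exists m, p, N; rewrite -[setT](setCK setT) setCT -UT setCK.
rewrite inE in zU; move=> le_n pp.
have [U' [m' [p' [N' [pp' ltU]]]]] := partial_partition_step pp zU.
apply: IHn pp'; rewrite -ltnS; apply: leq_trans le_n; apply: proper_card.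
by rewrite properC.
Qed.

Lemma Hpartition_of_disjointed :
  exists (H : graph) (phi : 'I_(gn G) -> 'I_(gn H)),
    [/\ tw_le H c, Hpartition phi & Hpart_width_le phi part_bound].
Proof.
have [m [p [N pp]]] := partial_partition_full.
pose adj : rel 'I_m := fun i j => (i != j) && ((val i \in N j) || (val j \in N i)).
have adj_sym : symmetric adj by move=> i j; rewrite /adj eq_sym orbC.
have adj_irr : irreflexive adj by move=> i; rewrite /adj eqxx.
exists (Graph adj_sym adj_irr), (fun v => Ordinal (pp_lt pp (in_setT v))); split.
- apply: (@tw_le_of_clique_order _ N) => /=.
  + exact: pp_nbr_lt pp.
  + exact: pp_clique pp.
  + exact: pp_nbr_size pp.
  + by move=> u v /andP[_ /orP].
- move=> u v /(pp_adj pp (in_setT u) (in_setT v)) uv.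
  have [eq_p|neq_p] := eqVneq (p u) (p v); first by left; apply: ord_inj.
  right; rewrite /= /adj -val_eqE /= neq_p /=.
  by case: uv => [/eqP|->//|->]; rewrite ?(negPf neq_p) ?orbT.
move=> i; apply: leq_trans (pp_size pp i); apply/subset_leq_card/subsetP=> v.
by rewrite !inE -val_eqE.
Qed.

End PartitionOfDisjointed.

(** * Attained minima and the equality of the two parameters *)

Lemma decPE (P : nat -> Prop) (n : nat) : Defs.decP P n <-> P n.
Proof. by rewrite /Defs.decP; case: excluded_middle_informative. Qed.

Lemma nat_minP (P : nat -> Prop) : (exists n, P n) -> P (nat_min P).
Proof.
move=> exP; rewrite /nat_min; case: excluded_middle_informative => // h.
by case: ex_minnP => n /decPE.
Qed.

Lemma nat_min_le (P : nat -> Prop) (n : nat) : P n -> nat_min P <= n.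
Proof.
move=> Pn; rewrite /nat_min; case: excluded_middle_informative => [h|[]]; last by exists n.
by case: ex_minnP => m _; apply; apply/decPE.
Qed.

Lemma eq_opt_min (P Q : nat -> Prop) : (forall n, P n <-> Q n) -> opt_min P = opt_min Q.
Proof.
move=> PQ; rewrite /opt_min.
case: excluded_middle_informative => [h|nP]; case: excluded_middle_informative => [h'|nQ] //.
- congr Some; case: ex_minnP => m /decPE/PQ Qm min_m; case: ex_minnP => n /decPE/PQ Pn min_n.
  by apply/eqP; rewrite eqn_leq min_m ?min_n //; apply/decPE.
- by case: nQ; have [n /PQ] := h; exists n.
- by case: nP; have [n /PQ] := h'; exists n.
Qed.

Lemma tw_le_tw (G : graph) : tw_le G (tw G).
Proof. by apply: nat_minP; exists (gn G); apply: tw_le_small. Qed.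

(** The partition into a single part is always available, so the minimum is attained and is not the
    default 0 of [nat_min]. *)
Lemma tpw_le_tpw (c : nat) (G : graph) : tpw_le c G (tpw c G).
Proof.
apply: nat_minP; exists (gn G).
have no_sym : symmetric (fun _ _ : 'I_1 => false) by [].
have no_irr : irreflexive (fun _ : 'I_1 => fun _ : 'I_1 => false) by [].
exists (Graph no_sym no_irr), (fun _ => ord0); split=> [|u v _|x]; last first.
- by apply: leq_trans (max_card _) _; rewrite card_ord.
- by left.
by apply: nat_min_le; apply: tw_le_small.
Qed.

Lemma disjointed_mono (G : graph) (c d d' : nat) (beta : {set {set 'I_(gn G)}}) :
  d <= d' -> disjointed c d beta -> disjointed c d' beta.
Proof.
move=> le_d dis Bs BsP U x xU X; have [Q [QX card_Q QP]] := dis Bs BsP x xU.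
by exists Q; split=> //; apply: leq_trans le_d.
Qed.

Lemma lpartition_mono (G : graph) (l l' : nat) (beta : {set {set 'I_(gn G)}}) :
  l <= l' -> lpartition l beta -> lpartition l' beta.
Proof.
by move=> le_l [triv cov size_beta]; split=> // B /size_beta /leq_trans; apply.
Qed.

Theorem theorem3p9 (C : graph -> Prop) (hC : graph_class C) :
  underlying_tw C =
  opt_min (fun c => exists g : nat -> nat,
             (forall k, 0 < g k) /\
             forall G, C G ->
               exists beta : {set {set 'I_(gn G)}},
                 lpartition (g (tw G)) beta /\ disjointed c (g (tw G)) beta).
Proof.
apply: eq_opt_min => c; split=> [[f fP]|[g [_ gP]]].
  (* One function has to bound the part size [f k] and the size [(c * c).+1 * f k] of Q; the
     successor makes it positive. *)
  exists (fun k => ((c * c).+1 * f k).+1); split=> // G CG.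
  have [H [phi [tw_H phiP size_phi]]] := tpw_le_tpw c G.
  have [beta [beta_l beta_d]] :=
    disjointed_of_Hpartition (tw_le_mono tw_H (tw_le_tw H)) phiP size_phi.
  have le_f := fP G CG; exists beta; split.
    apply: lpartition_mono beta_l; apply: leq_trans le_f _.
    by rewrite mulSn -addnS leq_addr.
  by apply: disjointed_mono beta_d; apply: leqW; rewrite leq_mul2l le_f orbT.
(* The function g bounds both the blocks and the sets Q, hence its two occurrences. *)
exists (fun k => part_bound c k (g k) (g k)) => G CG.
have [beta [beta_l beta_d]] := gP G CG.
have [H [phi [tw_H phiP size_phi]]] := Hpartition_of_disjointed (tw_le_tw G) beta_l beta_d.
by apply: nat_min_le; exists H, phi; split=> //; apply: nat_min_le.
Qed.
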